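(* Let $X$ be a finite nonempty set, let $\mathcal E^0$ be a collection of nonempty subsets of $X$, let $\mathfrak U$ be a calibrated representation-preserving integral scheme, and for each $E\in\mathcal E^0$ let $\mu_E\colon2^E\to[0,1]$ be a normalized capacity on $E$. There exists a normalized capacity $\mu$ on $X$ such that $$\mathfrak U_\mu(Z_{E,X}u)=\mathfrak U_{\mu_E}(u)\qquad\text{for all }E\in\mathcal E^0\text{ and }u\in[0,1]^E$$ if and only if the family $\{\mu_E:E\in\mathcal E^0\}$ is overlap compatible, i.e. $\mu_E(B)=\mu_F(B)$ for all $E,F\in\mathcal E^0$ and all $B\subseteq E\cap F$.
   Context: A normalized capacity on a finite nonempty set $Y$ is a map $\mu\colon2^Y\to[0,1]$ with $\mu(\emptyset)=0$, $\mu(Y)=1$, and $\mu(A)\le\mu(B)$ whenever $A\subseteq B\subseteq Y$. A set function is monotone if it is nondecreasing with respect to inclusion. For $F\subseteq E$ and $u\in[0,1]^F$, $Z_{F,E}u\in[0,1]^E$ equals $u$ on $F$ and $0$ on $E\setminus F$. $\mathbf 1_B$ denotes the indicator of $B\subseteq E$ as an element of $[0,1]^E$; $0_E$ is the zero profile. An integral scheme $\mathfrak U$ assigns to every finite set $E$, every monotone set function $\mu\colon2^E\to[0,1]$ with $\mu(\emptyset)=0$, and every $u\in[0,1]^E$ a value $\mathfrak U_\mu(u)\in[0,1]$. It is calibrated and representation preserving if: (U1) for all $u,v\in[0,1]^E$, $u\le v$ pointwise implies $\mathfrak U_\mu(u)\le\mathfrak U_\mu(v)$, and $\mathfrak U_\mu(0_E)=0$;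 (U2) $\mathfrak U_\mu(\mathbf 1_B)=\mu(B)$ for every $B\subseteq E$; (U3) whenever $F\subseteq E$ and monotone set functions $\lambda\colon2^F\to[0,1]$ and $\mu\colon2^E\to[0,1]$, both vanishing at $\emptyset$, satisfy $\mu|_{2^F}=\lambda$, then $\mathfrak U_\mu(Z_{F,E}u)=\mathfrak U_\lambda(u)$ for all $u\in[0,1]^F$. *)

(* Defs.v *)
From HB Require Import structures.
From mathcomp Require Import all_boot all_order all_algebra.
From mathcomp Require Import interval_inference reals.
Set Implicit Arguments.
Unset Strict Implicit.
Unset Printing Implicit Defensive.
Import Order.TTheory GRing.Theory Num.Theory.
Local Open Scope ring_scope.

(* A subset F of a finite set E, regarded as a finite set in its own right. *)
Definition subfin (E : finType) (F : {set E}) : finType := {x : E | x \in F}.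

(* [lift_set A] is A, a set of elements of F, seen as a subset of E;
   [restr_set F B] is B, a subset of E contained in F, seen as a set of
   elements of F (if B is not contained in F, this is B :&: F). *)
Definition lift_set (E : finType) (F : {set E}) (A : {set subfin F}) : {set E} :=
  [set sval x | x in A].

Definition restr_set (E : finType) (F B : {set E}) : {set subfin F} :=
  [set x | sval x \in B].

Section Schemes.
Variable R : realType.

Definition profile (E : finType) := {ffun E -> {i01 R}}.

Definition zero_profile (E : finType) : profile E := [ffun=> 0%:i01].

Definition indicator (E : finType) (B : {set E}) : profile E :=
  [ffun x => if x \in B then 1%:i01 else 0%:i01].

(* Z_{F,E} u: here [insub x] is [Some y] with [sval y = x] if x is in F, and
   [None] otherwise. *)
Definition zero_ext (E : finType) (F : {set E}) (u : profile (subfin F)) :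
    profile E :=
  [ffun x => if insub x is Some y then u y else 0%:i01].

Record monotone_setfun (E : finType) := MonotoneSetfun {
  setfun_val :> {ffun {set E} -> {i01 R}};
  setfun0 : setfun_val set0 = 0%:i01;
  setfun_mono : forall A B : {set E},
    A \subset B -> setfun_val A <= setfun_val B }.

(* No such record exists when E is empty, as 0 and 1 are distinct. *)
Record capacity (E : finType) := Capacity {
  capacity_setfun :> monotone_setfun E;
  capacityT : capacity_setfun [set: E] = 1%:i01 }.

Definition integral_scheme :=
  forall E : finType, monotone_setfun E -> profile E -> {i01 R}.

Record calibrated_representation_preserving (U : integral_scheme) : Prop := {
  scheme_mono : forall (E : finType) (mu : monotone_setfun E) (u v : profile E),
    (forall x, u x <= v x) -> U E mu u <= U E mu v;
  scheme_zero : forall (E : finType) (mu : monotone_setfun E),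
    U E mu (zero_profile E) = 0%:i01;
  scheme_indicator : forall (E : finType) (mu : monotone_setfun E) (B : {set E}),
    U E mu (indicator B) = mu B;
  scheme_restr : forall (E : finType) (F : {set E})
      (lambda : monotone_setfun (subfin F)) (mu : monotone_setfun E),
    (forall A : {set subfin F}, mu (lift_set A) = lambda A) ->
    forall u : profile (subfin F), U E mu (zero_ext u) = U (subfin F) lambda u }.

(* A family of capacities is indexed by membership proofs because the empty
   subset of X carries no capacity: a family indexed by all subsets of X would
   not exist. *)
Definition overlap_compatible (X : finType) (E0 : {set {set X}})
    (muE : forall E : {set X}, E \in E0 -> capacity (subfin E)) : Prop :=
  forall (E F : {set X}) (hE : E \in E0) (hF : F \in E0) (B : {set X}),
    B \subset E :&: F ->
    muE E hE (restr_set E B) = muE F hF (restr_set F B).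

End Schemes.

(* Main.v *)
(* Testing the integral on indicators recovers the capacity, which forces overlap
   compatibility. Conversely, the smallest monotone extension
   A |-> max_E mu_E (A :&: E), raised to 1 at A = X, restricts to each mu_E: for
   A contained in E, compatibility gives
   mu_F (A :&: F) = mu_E (A :&: F) <= mu_E A. *)
Require Import Defs.
From HB Require Import structures.
From mathcomp Require Import all_boot all_order all_algebra.
From mathcomp Require Import interval_inference reals.
Set Implicit Arguments.
Unset Strict Implicit.
Unset Printing Implicit Defensive.
Import Order.TTheory GRing.Theory Num.Theory.
Local Open Scope ring_scope.

Lemma lift_setK (E : finType) (F : {set E}) :
  cancel (@lift_set E F) (restr_set F).
Proof.
move=> A; apply/setP=> x; rewrite inE; apply/imsetP/idP => [[y yA /val_inj ->]//|xA].
by exists x.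
Qed.

Lemma lift_set_sub (E : finType) (F : {set E}) (A : {set subfin F}) :
  lift_set A \subset F.
Proof. by apply/subsetP=> _ /imsetP[y _ ->]; exact: (valP y). Qed.

Lemma restr_setS (E : finType) (F A B : {set E}) :
  A \subset B -> restr_set F A \subset restr_set F B.
Proof. by move=> /subsetP sAB; apply/subsetP=> x; rewrite !inE => /sAB. Qed.

Lemma restr_set0 (E : finType) (F : {set E}) : restr_set F set0 = set0.
Proof. by apply/setP=> x; rewrite !inE. Qed.

Lemma restr_setT (E : finType) (F : {set E}) : restr_set F setT = setT.
Proof. by apply/setP=> x; rewrite !inE. Qed.

Lemma restr_setI (E : finType) (F B : {set E}) :
  restr_set F (B :&: F) = restr_set F B.
Proof. by apply/setP=> x; rewrite !inE (valP x) andbT. Qed.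

(** This makes the indicator of [B] a test profile coming from every [F] that contains [B], so
    values of different capacities at [B] can be compared through one integral on [E]. *)
Lemma zero_ext_indicator (R : realType) (E : finType) (F B : {set E}) :
  B \subset F ->
  zero_ext (indicator R (restr_set F B)) = indicator R B.
Proof.
move=> /subsetP sBF; apply/ffunP=> x; rewrite !ffunE.
case: insubP => [y _ <-|xF]; first by rewrite ffunE inE.
by case: ifP => // /sBF; rewrite (negbTE xF).
Qed.

Lemma i01_ge0 (R : realType) (x : {i01 R}) : 0%:i01 <= x.
Proof. by rewrite -num_le /=. Qed.

Lemma i01_le1 (R : realType) (x : {i01 R}) : x <= 1%:i01.
Proof. by rewrite -num_le /=. Qed.

Section Envelope.
Variables (R : realType) (X : finType) (E0 : {set {set X}}).
Variable muE : forall E : {set X}, E \in E0 -> capacity R (subfin E).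

(** The index type carries membership proofs because [muE] requires them. The default 0 is the
    bottom of the unit interval and the value of the maximum when [E0] is empty. *)
Definition envelope (A : {set X}) : {i01 R} :=
  \big[Order.max/0%:i01]_(p : {E : {set X} | E \in E0})
    muE (svalP p) (restr_set (sval p) A).

(** The value at [setT] is imposed for the sake of an empty [E0], where the envelope vanishes
    identically; any member of [E0] already gives 1 there. *)
Definition top_envelope : {ffun {set X} -> {i01 R}} :=
  [ffun A => if A == setT then 1%:i01 else envelope A].

Lemma envelope0 : envelope set0 = 0%:i01.
Proof.
apply/eqP; rewrite eq_le i01_ge0 andbT.
by apply/bigmax_leP; split=> // p _; rewrite restr_set0 setfun0.
Qed.

Lemma envelopeS (A B : {set X}) : A \subset B -> envelope A <= envelope B.
Proof.
by move=> sAB; apply: le_bigmax2 => p _; apply/setfun_mono/restr_setS.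
Qed.

(** Nonemptiness of [X] keeps [set0] apart from [setT], where the value is 1. *)
Lemma top_envelope0 : (0 < #|X|)%N -> top_envelope set0 = 0%:i01.
Proof.
by move=> X0; rewrite ffunE envelope0 eqEcard cardsT cards0 leqNgt X0 andbF.
Qed.

Lemma top_envelopeS (A B : {set X}) :
  A \subset B -> top_envelope A <= top_envelope B.
Proof.
move=> sAB; rewrite !ffunE; case: (B =P setT) => [_|BT]; first exact: i01_le1.
case: eqP => [AT|_]; last exact: envelopeS.
by case: BT; apply/eqP; rewrite -subTset -AT.
Qed.

Lemma top_envelopeT : top_envelope setT = 1%:i01.
Proof. by rewrite ffunE eqxx. Qed.

Definition envelope_capacity (X0 : (0 < #|X|)%N) : capacity R X :=
  Capacity (capacity_setfun := MonotoneSetfun (top_envelope0 X0) top_envelopeS)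
    top_envelopeT.

Lemma envelope_lift (E : {set X}) (hE : E \in E0) (A : {set subfin E}) :
  overlap_compatible muE -> envelope (lift_set A) = muE hE A.
Proof.
move=> ov; apply/eqP; rewrite eq_le; apply/andP; split.
  apply/bigmax_leP; split=> [|[F hF] _ /=]; first exact: i01_ge0.
  (* Trimming [lift_set A] to its part in [F] puts it inside both [E] and [F], as [ov] demands. *)
  rewrite -restr_setI -(ov E F hE); last by rewrite setSI ?lift_set_sub.
  rewrite -[A in leRHS]lift_setK.
  exact/setfun_mono/restr_setS/subsetIl.
(* For the other inequality, [E] itself is an index of the maximum, up to the choice of membership
   proof. *)
rewrite -[A in leLHS]lift_setK /envelope.
pose p : {E : {set X} | E \in E0} := exist _ E hE.
have -> : hE = svalP p by exact: bool_irrelevance.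
exact: (le_bigmax _ (fun q => muE (svalP q) (restr_set (sval q) (lift_set A))) p).
Qed.

Lemma top_envelope_lift (E : {set X}) (hE : E \in E0) (A : {set subfin E}) :
  overlap_compatible muE -> top_envelope (lift_set A) = muE hE A.
Proof.
move=> ov; rewrite ffunE; case: eqP => [AT|_]; last exact: envelope_lift.
(* If [A] lifts to all of [X], then [A] is the full set of [subfin E], and normalization of the
   capacity on [E] matches the imposed value 1. *)
by rewrite -[A]lift_setK AT restr_setT capacityT.
Qed.

End Envelope.

Theorem theorem6p5 (R : realType) (X : finType) (hX : (0 < #|X|)%N)
  (E0 : {set {set X}}) (hE0 : forall E : {set X}, E \in E0 -> E != set0)
  (U : integral_scheme R) (hU : calibrated_representation_preserving U)
  (muE : forall E : {set X}, E \in E0 -> capacity R (subfin E)) :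
  (exists mu : capacity R X,
     forall (E : {set X}) (hE : E \in E0) (u : profile R (subfin E)),
       U X mu (zero_ext u) = U (subfin E) (muE E hE) u)
  <-> overlap_compatible muE.
Proof.
split=> [[mu ext] E F hE hF B|ov].
  rewrite subsetI => /andP[sBE sBF].
  have muB (G : {set X}) (hG : G \in E0) : B \subset G ->
      muE G hG (restr_set G B) = mu B.
    move=> sBG; rewrite -(scheme_indicator hU) -ext zero_ext_indicator //.
    exact: scheme_indicator.
  by rewrite !muB.
exists (envelope_capacity muE hX) => E hE u.
(* Representation preservation reduces equality of integrals to agreement of the set functions on
   subsets of [E]. *)
by apply: (scheme_restr hU) => A; exact: top_envelope_lift.
Qed.
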